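(* Let $p\ge 1$ and let $H_{\gamma_1},\dots,H_{\gamma_{p+1}}$ be translation-invariant operators on a system of fermionic modes located on a lattice, each of the form $$H_{\gamma_i}=J^{(\gamma_i)}\sum_{\vec j}h^{(\gamma_i)}_{\vec j},$$ where $J^{(\gamma_i)}$ is a scalar, each $h^{(\gamma_i)}_{\vec j}$ is a number-preserving fermionic operator (NPFO) with locality $k^{(\gamma_i)}$, and, for each fixed $\gamma_i$, the terms $h^{(\gamma_i)}_{\vec j}$ have pairwise disjoint supports. Then for every $\eta$, $$\big\|[H_{\gamma_{p+1}},[H_{\gamma_p},\dots,[H_{\gamma_2},H_{\gamma_1}]\dots]]\big\|_\eta\le\Big(\prod_{n=1}^{p+1}|J^{(\gamma_n)}|\Big)\prod_{m=2}^{p+1}\Big[2k^{(\gamma_m)}(k^{(\gamma_m)}-1)\Big(\sum_{n=1}^{m-1}k^{(\gamma_n)}-(m-2)\Big)\Big(\sum_{n=1}^{m-1}k^{(\gamma_n)}-(m-1)\Big)2^{1+\min\{k^{(\gamma_m)},\,\sum_{n=1}^{m-1}k^{(\gamma_n)}-(m-2)\}/2}\Big]\Big\lceil\frac{\eta}{\lceil k_{\min}/2\rceil}\Big\rceil,$$ where $k_{\min}=\min_{1\le i\le p+1}k^{(\gamma_i)}$.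
   Context: Fermionic modes $i$ on a lattice have annihilation/creation operators $a(i),a^\dagger(i)$ with $\{a(i),a^\dagger(j)\}=\delta_{ij}$, $\{a(i),a(j)\}=\{a^\dagger(i),a^\dagger(j)\}=0$, and $N(i)=a^\dagger(i)a(i)$. NPFO: for a tuple $\vec i=(i_1,\dots,i_k)$ of pairwise distinct modes, a number-preserving fermionic operator is an operator $h_{\vec i}=a^\dagger(i_1)\cdots a^\dagger(i_m)\,a(i_{m+1})\cdots a(i_{2m})\,N(i_{2m+1})\cdots N(i_k)$ (equally many creation and annihilation operators, for some $0\le 2m\le k$). Its support is $\{i_1,\dots,i_k\}$ and its locality is $k$, the number of modes it acts on. Translation invariance of $H_{\gamma}=J\sum_{\vec j}h_{\vec j}$ means that all the terms $h_{\vec j}$ in the sum are lattice translates of one another and $\vec j$ ranges over a translation-invariant family of tuples of modes. Fermionic semi-norm: for a number-preserving operator $X$, $\|X\|_\eta=\max|\langle\psi_\eta|X|\phi_\eta\rangle|$, the maximum being over normalized states $\psi_\eta,\phi_\eta$ with exactly $\eta$ fermions.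
   Formalization: The lattice is finite and periodic, every locality is at least 1, and locality 1 is allowed only with at most one mode per unit cell: otherwise the bound is 0 and fails, e.g. for H_1 a sum of up-down hoppings and H_2 the number of up fermions. *)

(* Defs.v *)
From HB Require Import structures.
From mathcomp Require Import all_boot all_order all_algebra.
From mathcomp Require Import all_classical all_reals all_analysis.
From mathcomp Require Import complex.

Set Implicit Arguments.
Unset Strict Implicit.
Unset Printing Implicit Defensive.

Import Order.TTheory GRing.Theory Num.Theory.

Local Open Scope classical_set_scope.
Local Open Scope complex_scope.
Local Open Scope ring_scope.

Definition adj (R : realType) (m n : nat) (A : 'M[R[i]]_(m, n)) : 'M[R[i]]_(n, m) :=
  (map_mx Num.conj A)^T.

Definition comm (R : realType) (D : nat) (A B : 'M[R[i]]_D) : 'M[R[i]]_D :=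
  A *m B - B *m A.

Definition acomm (R : realType) (D : nat) (A B : 'M[R[i]]_D) : 'M[R[i]]_D :=
  A *m B + B *m A.

Definition cmod (R : realType) (z : R[i]) : R := ComplexField.Normc.normc z.

(* The canonical anticommutation relations for modes indexed by M, acting on
   the Hilbert space C^D. No ordering of the modes (Jordan-Wigner) is chosen,
   and the representation need not be irreducible. *)
Definition CAR (R : realType) (D : nat) (M : finType) (a : M -> 'M[R[i]]_D) : Prop :=
  (forall i j, acomm (a i) (adj (a j)) = (i == j)%:R%:M) /\
  (forall i j, acomm (a i) (a j) = 0) /\
  (forall i j, acomm (adj (a i)) (adj (a j)) = 0).

Definition number (R : realType) (D : nat) (M : finType) (a : M -> 'M[R[i]]_D)
    (x : M) : 'M[R[i]]_D :=
  adj (a x) *m a x.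

(* The products are taken in the order of the list: the first m modes are
   created, the next m annihilated, and the remaining ones counted. *)
Definition npfo (R : realType) (D : nat) (M : finType) (a : M -> 'M[R[i]]_D)
    (m : nat) (s : seq M) : 'M[R[i]]_D :=
  (\big[mulmx/1%:M]_(x <- take m s) adj (a x)) *m
  (\big[mulmx/1%:M]_(x <- take m (drop m s)) a x) *m
  (\big[mulmx/1%:M]_(x <- drop (2 * m) s) number a x).

(* A (periodic) lattice: G is the finite abelian group of lattice translations,
   for instance Z/L_1 x ... x Z/L_d, and S is the set of modes in a unit cell. *)
Definition mode (G : finZmodType) (S : finType) : finType := (G * S)%type.

Definition translate (G : finZmodType) (S : finType) (g : G)
    (x : mode G S) : mode G S :=
  (x.1 + g, x.2).

(* The data of J \sum_j h_j: all terms have the same locality and the same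
   number of creation operators, and j ranges over op_family. *)
Record lattice_op (R : realType) (M : finType) := LatticeOp {
  op_coef : R[i];
  locality : nat;
  op_ladder : nat;
  op_family : {set locality.-tuple M}
}.

Definition to_matrix (R : realType) (D : nat) (M : finType)
    (a : M -> 'M[R[i]]_D) (H : lattice_op R M) : 'M[R[i]]_D :=
  op_coef H *: \sum_(j in op_family H) npfo a (op_ladder H) j.

Definition npfo_terms (R : realType) (M : finType) (H : lattice_op R M) : Prop :=
  (2 * op_ladder H <= locality H)%N /\
  (forall j, j \in op_family H -> uniq j).

Definition translation_invariant (R : realType) (G : finZmodType) (S : finType)
    (H : lattice_op R (mode G S)) : Prop :=
  (forall (g : G) j, j \in op_family H ->
     map_tuple (translate g) j \in op_family H) /\
  (forall j j', j \in op_family H -> j' \in op_family H ->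
     exists g : G, j' = map_tuple (translate g) j).

Definition disjoint_supports (R : realType) (M : finType)
    (H : lattice_op R M) : Prop :=
  forall j j', j \in op_family H -> j' \in op_family H -> j != j' ->
    forall x, x \in j -> x \notin j'.

(* nested_comm H p = [H (p+1), [H p, ..., [H 2, H 1] ... ]] *)
Fixpoint nested_comm (R : realType) (D : nat) (H : nat -> 'M[R[i]]_D) (p : nat)
    : 'M[R[i]]_D :=
  match p with
  | 0 => H 1%N
  | q.+1 => comm (H q.+2) (nested_comm H q)
  end.

Definition fermion_state (R : realType) (D : nat) (M : finType)
    (a : M -> 'M[R[i]]_D) (eta : nat) (psi : 'cV[R[i]]_D) : Prop :=
  adj psi *m psi = 1%:M /\
  (\sum_(x : M) number a x) *m psi = eta%:R *: psi.

Definition amplitudes (R : realType) (D : nat) (M : finType)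
    (a : M -> 'M[R[i]]_D) (eta : nat) (X : 'M[R[i]]_D) : set R :=
  [set r | exists psi phi : 'cV[R[i]]_D,
     [/\ fermion_state a eta psi, fermion_state a eta phi &
         r = cmod ((adj psi *m X *m phi) 0 0)]].

(* The supremum is over a bounded set (amplitudes_ubound), and it is 0 when
   there is no state with eta fermions. *)
Definition fermionic_norm (R : realType) (D : nat) (M : finType)
    (a : M -> 'M[R[i]]_D) (eta : nat) (X : 'M[R[i]]_D) : R :=
  sup (amplitudes a eta X).

Lemma state_entry_le1 (R : realType) (D : nat) (psi : 'cV[R[i]]_D) (i : 'I_D) :
  adj psi *m psi = 1%:M -> `|psi i 0| <= 1.
Proof.
move=> /matrixP /(_ 0 0); rewrite !mxE eqxx mulr1n => h.
have {}h : \sum_j `|psi j 0| ^+ 2 = 1.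
  by rewrite -[RHS]h; apply: eq_bigr => j _; rewrite !mxE normCK mulrC.
rewrite -(@expr_le1 _ 2) // -h (bigD1 i) //= lerDl.
by apply: sumr_ge0 => j _; rewrite exprn_ge0.
Qed.

Lemma amplitudes_ubound (R : realType) (D : nat) (M : finType)
    (a : M -> 'M[R[i]]_D) (eta : nat) (X : 'M[R[i]]_D) :
  has_ubound (amplitudes a eta X).
Proof.
exists (complex.Re (\sum_i \sum_j `|X i j|)) => r [psi [phi [[h1 _] [h2 _] ->]]].
rewrite -lecR.
have -> : (complex.Re (\sum_i \sum_j `|X i j|))%:C = \sum_i \sum_j `|X i j|.
  apply: RRe_real; apply: ger0_real.
  by apply: sumr_ge0 => i _; apply: sumr_ge0.
have -> : (cmod ((adj psi *m X *m phi) 0 0))%:C = `|(adj psi *m X *m phi) 0 0| by [].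
rewrite -mulmxA !mxE; apply: le_trans (ler_norm_sum _ _ _) _.
apply: ler_sum => i _; rewrite normrM !mxE norm_conjC.
rewrite -[leRHS]mul1r; apply: ler_pM => //; first exact: state_entry_le1.
apply: le_trans (ler_norm_sum _ _ _) _; apply: ler_sum => j _.
by rewrite normrM ler_piMr // state_entry_le1.
Qed.

(* cumul k m = k 1 + ... + k (m - 1) *)
Definition cumul (k : nat -> nat) (m : nat) : nat := \sum_(1 <= n < m) k n.

Definition kmin (k : nat -> nat) (p : nat) : nat :=
  \big[minn/k 1%N]_(1 <= n < p.+2) k n.

Definition level_factor (R : realType) (k : nat -> nat) (m : nat) : R :=
  2 * (k m)%:R * ((k m)%:R - 1) *
  ((cumul k m)%:R - (m%:R - 2)) * ((cumul k m)%:R - (m%:R - 1)) *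
  2 `^ (1 + Num.min (k m)%:R ((cumul k m)%:R - (m%:R - 2)) / 2).

(* Main.v *)
Require Import Defs.
From HB Require Import structures.
From mathcomp Require Import all_boot all_order all_algebra.
From mathcomp Require Import all_classical all_reals all_analysis.
From mathcomp Require Import complex.
From mathcomp Require Import zify lra.

Set Implicit Arguments.
Unset Strict Implicit.
Unset Printing Implicit Defensive.

Import Order.TTheory GRing.Theory Num.Theory.

Local Open Scope complex_scope.
Local Open Scope ring_scope.

(* Since NPFOs with disjoint supports commute, the nested commutator is a sum
   over clusters (j_1, ..., j_(p+1)) in which every term overlaps an earlier one,
   and each cluster contributes 2^p signed products P of contractions. The
   leftmost factor of P absorbs N(y) on the left for at least q = ceil(kmin/2) of
   its modes y, and the rightmost factor absorbs N(x) on the right for at least q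
   of its modes x, so
     |<psi|P|phi>| = |<N(y) psi|P|N(x) phi>| <= (|a(y) psi|^2 + |a(x) phi|^2) / 2.
   Averaging over y and x bounds this by 1/(2q) times the total occupation of the
   cluster in psi plus that in phi. As the terms of one operator are disjoint, the
   number T of clusters through a fixed mode is at most
   prod_(m=2)^(p+1) (k_1 + ... + k_m), and the occupations of all modes add up to
   eta, whence the bound 2^p T eta / q. If every k_n is at least 2, the factor
   2 (k_1 + ... + k_m) is at most the m-th factor of the theorem. If some k_n is 1,
   then H_n is a multiple of the total number operator, which commutes with all
   the other operators, and both sides vanish. *)

(** * Words in operators obeying the canonical anticommutation relations *)

Lemma anticomm_mul (A : pzRingType) (o c d : A) :
  o * c = - (c * o) -> o * d = - (d * o) -> o * (c * d) = c * d * o.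
Proof. by move=> e1 e2; rewrite mulrA e1 mulNr -mulrA e2 mulrN opprK mulrA. Qed.

Section CarWords.
Variables (A : pzRingType) (M : finType) (cr an : M -> A).
Hypothesis an_cr : forall i j, an i * cr j = (i == j)%:R - cr j * an i.
Hypothesis an_an : forall i j, an i * an j = - (an j * an i).
Hypothesis cr_cr : forall i j, cr i * cr j = - (cr j * cr i).
Hypothesis sqr_an : forall i, an i * an i = 0.
Hypothesis sqr_cr : forall i, cr i * cr i = 0.

(* [Some true], [Some false] and [None] stand for creation, annihilation and number. *)
Definition car_ladder (b : option bool) (x : M) : A :=
  match b with
  | Some true => cr x | Some false => an x | None => cr x * an x
  end.

Local Notation N x := (car_ladder None x).

Lemma numberE x : N x = cr x * an x. Proof. by []. Qed.

Definition car_word (s : seq (option bool * M)) : A := \prod_(z <- s) car_ladder z.1 z.2.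

Lemma word_cons z s : car_word (z :: s) = car_ladder z.1 z.2 * car_word s.
Proof. by rewrite /car_word big_cons. Qed.

(** Since [an x] squares to zero, [an x * (cr x * an x) = (1 - cr x * an x) * an x = an x]; the
    number case follows. *)
Lemma ladder_number b x : b != Some true -> car_ladder b x * N x = car_ladder b x.
Proof.
have ax : an x * (cr x * an x) = an x.
  by rewrite mulrA an_cr eqxx mulrBl mul1r -mulrA sqr_an mulr0 subr0.
by case: b => [[]|] //= _; rewrite -mulrA ax.
Qed.

Lemma number_ladder b x : b != Some false -> N x * car_ladder b x = car_ladder b x.
Proof.
have ax : cr x * an x * cr x = cr x.
  by rewrite -mulrA an_cr eqxx mulrBr mulr1 mulrA sqr_cr mul0r subr0.
by case: b => [[]|] //= _; rewrite mulrA ax.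
Qed.

(** Each ladder operator crossed gives a factor -1; a number operator gives none, being a product of
    two of them. *)
Lemma ladder_word (b : bool) x s : x \notin map snd s ->
  car_ladder (Some b) x * car_word s =
  (-1) ^+ count (fun z => isSome z.1) s * (car_word s * car_ladder (Some b) x).
Proof.
elim: s => [_|[b' y] s ih]; first by rewrite /car_word big_nil expr0 !mul1r mulr1.
rewrite inE negb_or => /andP[/= nxy /ih {}ih].
have swap : car_ladder (Some b) x * car_ladder b' y =
    (-1) ^+ isSome b' * (car_ladder b' y * car_ladder (Some b) x).
  have hxy := negPf nxy; have hyx : (y == x) = false by rewrite eq_sym.
  have q1 (b1 b2 : bool) :
    car_ladder (Some b1) x * car_ladder (Some b2) y =
    - (car_ladder (Some b2) y * car_ladder (Some b1) x).
    case: b1 b2 => [] [] /=; rewrite ?(an_an x y) ?(cr_cr x y) //.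
      by rewrite an_cr hyx sub0r opprK.
    by rewrite an_cr hxy sub0r.
  case: b' => [b'|] /=; first by rewrite q1 expr1 mulN1r.
  by rewrite expr0 mul1r; apply: anticomm_mul (q1 b true) (q1 b false).
rewrite !word_cons /= exprD mulrA swap -!mulrA ih.
congr (_ * _); rewrite !mulrA; congr (_ * _ * _).
exact: commr_sign.
Qed.

Lemma number_word_comm x s : x \notin map snd s -> N x * car_word s = car_word s * N x.
Proof.
move=> hx; have h1 := ladder_word true hx; have h2 := ladder_word false hx.
move: h1 h2; rewrite /= -signr_odd.
case: (odd _); rewrite ?expr1 ?expr0 ?mulN1r ?mul1r => h1 h2.
  by rewrite -mulrA h2 mulrN mulrA h1 mulNr opprK mulrA.
by rewrite -mulrA h2 mulrA h1 mulrA.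
Qed.

(** The parity of [t] is enough: each ladder factor of [s] crosses the whole of [t] with sign +1. *)
Lemma word_commute s t :
  ~~ odd (count (fun z => isSome z.1) t) ->
  (forall x, x \in map snd s -> x \notin map snd t) ->
  car_word s * car_word t = car_word t * car_word s.
Proof.
move=> ev; elim: s => [_|[b x] s ih hd]; first by rewrite /car_word big_nil mul1r mulr1.
have /= hx := hd x (mem_head _ _).
rewrite word_cons /= -mulrA ih; last by move=> y ys; apply: hd; rewrite inE ys orbT.
rewrite !mulrA; congr (_ * _); clear hd.
case: b => [b|]; last exact: number_word_comm.
by rewrite ladder_word // -signr_odd (negPf ev) expr0 mul1r.
Qed.

(** As the modes are distinct, [N x] slides left to the only factor at [x], which absorbs it. *)
Lemma word_number b x s : uniq (map snd s) -> (b, x) \in s -> b != Some true ->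
  car_word s * N x = car_word s.
Proof.
move=> + + hb; elim: s => [//|[c y] s ih] /= /andP[ny us].
rewrite inE word_cons /= => /orP[/eqP[cb xy]|hx]; last by rewrite -mulrA ih.
by rewrite -{}cb -{}xy in ny *; rewrite -mulrA -number_word_comm // mulrA ladder_number.
Qed.

Lemma number_word b x s : uniq (map snd s) -> (b, x) \in s -> b != Some false ->
  N x * car_word s = car_word s.
Proof.
move=> + + hb; elim: s => [//|[c y] s ih] /= /andP[ny us].
rewrite inE word_cons /= => /orP[/eqP[cb xy]|hx].
  by rewrite -{}cb -{}xy in ny *; rewrite mulrA number_ladder.
have nxy : x \notin map snd [:: (c, y)].
  by rewrite inE /=; apply: contraNneq ny => <-; apply/mapP; exists (b, x).
have e : N x * car_ladder c y = car_ladder c y * N x.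
  by have := number_word_comm nxy; rewrite /car_word big_seq1.
by rewrite mulrA e -mulrA ih.
Qed.

Lemma total_number_ladder b y : let NT := \sum_x N x in
  NT * car_ladder b y = car_ladder b y * NT + car_ladder b y *+ (b == Some true)
                    - car_ladder b y *+ (b == Some false).
Proof.
move=> NT.
have qa : NT * an y = an y * NT - an y.
  (* Writing [an y] as a sum of Kronecker deltas reduces the identity to one check per mode. *)
  rewrite /NT mulr_suml mulr_sumr -[X in _ - X](_ : \sum_x (x == y)%:R * an y = an y); last first.
    rewrite (bigD1 y) //= eqxx mul1r big1 ?addr0 // => x /negPf ->.
    by rewrite mul0r.
  rewrite -sumrB; apply: eq_bigr => x _; rewrite numberE -mulrA an_an mulrN.
  rewrite !mulrA an_cr (eq_sym y) mulrBl.
  case: (eqVneq x y) => [->|_]; first by rewrite !mul1r addrAC subrr sub0r.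
  by rewrite !mul0r sub0r subr0.
have qc : NT * cr y = cr y * NT + cr y.
  rewrite /NT mulr_suml mulr_sumr -[X in _ + X](_ : \sum_x cr y * (x == y)%:R = cr y); last first.
    rewrite (bigD1 y) //= eqxx mulr1 big1 ?addr0 // => x /negPf ->.
    by rewrite mulr0.
  rewrite -big_split; apply: eq_bigr => x _ /=; rewrite -mulrA an_cr mulrBr.
  rewrite (mulrA (cr x) (cr y)) (cr_cr x y) mulNr opprK -mulrA addrC.
  by case: (eqVneq x y) => [->//|_]; rewrite !mulr0.
case: b => [[]|] /=; first by rewrite mulr0n mulr1n subr0.
  by rewrite mulr0n mulr1n addr0.
(* For a number factor the shifts +1 from [cr y] and -1 from [an y] cancel. *)
rewrite !mulr0n addr0 subr0 mulrA qc mulrDl -!mulrA qa.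
by rewrite mulrBr subrK.
Qed.

Lemma total_number_word s : let NT := \sum_x N x in
  NT * car_word s = car_word s * NT + car_word s *+ count (fun z => z.1 == Some true) s
                - car_word s *+ count (fun z => z.1 == Some false) s.
Proof.
move=> NT; elim: s => [|[b y] s ih] /=.
  by rewrite /car_word big_nil mul1r mulr1 !mulr0n addr0 subr0.
rewrite word_cons /= mulrA total_number_ladder !mulrBl !mulrDl -!mulrA ih.
rewrite !mulrBr !mulrDr !mulrnAr !mulrnAl !mulrnDr opprD !addrA.
set X := car_ladder b y * _; set P := _ *+ count _ _; set Q := _ *+ count _ _.
by rewrite (addrAC (X + P) (- Q)) (addrAC X P) (addrAC _ (- Q)).
Qed.

End CarWords.

(** * Squared norms and nonexpansive matrices *)

Section SquaredNorm.
Variables (R : realType) (D : nat).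
Implicit Types (A B : 'M[R[i]]_D) (u v : 'cV[R[i]]_D).

Lemma adjM m n q (A : 'M[R[i]]_(m, n)) (B : 'M[R[i]]_(n, q)) :
  adj (A *m B) = adj B *m adj A.
Proof. by rewrite /adj map_mxM trmx_mul. Qed.

Lemma adjK m n (A : 'M[R[i]]_(m, n)) : adj (adj A) = A.
Proof. by apply/matrixP => i j; rewrite !mxE conjCK. Qed.

Definition normsq v : R[i] := (adj v *m v) 0 0.

Lemma normsqE v : normsq v = \sum_i `|v i 0| ^+ 2.
Proof.
by rewrite /normsq mxE; apply: eq_bigr => i _; rewrite !mxE normCK mulrC.
Qed.

Lemma normsq_ge0 v : 0 <= normsq v.
Proof. by rewrite normsqE; apply: sumr_ge0 => i _; rewrite exprn_ge0. Qed.

Lemma normsqN v : normsq (- v) = normsq v.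
Proof. by rewrite !normsqE; apply: eq_bigr => i _; rewrite mxE normrN. Qed.

(** Arithmetic-geometric mean on each entry. A sum on the right, unlike a product of norms, can
    later be added up over clusters. *)
Lemma inner_le u v : `|(adj u *m v) 0 0| *+ 2 <= normsq u + normsq v.
Proof.
rewrite !normsqE -big_split /= mxE.
apply: (@le_trans _ _ ((\sum_i `|u i 0| * `|v i 0|) *+ 2)).
  rewrite lerMn2r /=; apply: le_trans (ler_norm_sum _ _ _) _.
  by apply: ler_sum => i _; rewrite normrM !mxE norm_conjC.
rewrite -sumrMnl; apply: ler_sum => i _.
exact: (real_leif_mean_square_scaled (normr_real _) (normr_real _)).1.
Qed.

(** Operator norm at most 1, phrased without operator norms or square roots. *)
Definition nonexpansive A := forall v, normsq (A *m v) <= normsq v.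

Lemma nonexpansive1 : nonexpansive 1.
Proof. by move=> v; rewrite mul1mx. Qed.

Lemma nonexpansiveM A B : nonexpansive A -> nonexpansive B -> nonexpansive (A * B).
Proof.
by move=> hA hB v; rewrite -[A * B]/(A *m B) -mulmxA; apply: le_trans (hA _) (hB _).
Qed.

Lemma nonexpansiveN A : nonexpansive A -> nonexpansive (- A).
Proof. by move=> hA v; rewrite mulNmx normsqN. Qed.

End SquaredNorm.

(** * Number-preserving operators as words of matrices *)

Section MatrixWords.
Variables (R : realType) (D : nat) (M : finType) (a : M -> 'M[R[i]]_D).
Hypothesis ha : CAR a.
Local Notation N := (Defs.number a).
Local Notation word := (@car_word 'M[R[i]]_D M (fun x => adj (a x)) a).
Local Notation ladder := (@car_ladder 'M[R[i]]_D M (fun x => adj (a x)) a).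

Lemma bool_scalar (b : bool) : (b%:R)%:M = b%:R :> 'M[R[i]]_D.
Proof. by case: b => //; rewrite raddf0. Qed.

Lemma mul_a_adj i j : a i * adj (a j) = (i == j)%:R - adj (a j) * a i.
Proof. by apply/eqP; rewrite -subr_eq opprK -bool_scalar -ha.1. Qed.

Lemma mul_a_a i j : a i * a j = - (a j * a i).
Proof. by apply/eqP; rewrite -addr_eq0; apply/eqP/ha.2.1. Qed.

Lemma mul_adj_adj i j : adj (a i) * adj (a j) = - (adj (a j) * adj (a i)).
Proof. by apply/eqP; rewrite -addr_eq0; apply/eqP/ha.2.2. Qed.

Lemma eq_opp_mx0 (A : 'M[R[i]]_D) : A = - A -> A = 0.
Proof.
move=> hA; apply/matrixP => i j; rewrite mxE; apply/eqP.
have /eqP := congr1 (fun B : matrix R[i] D D => B i j) hA.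
by rewrite mxE -addr_eq0 -mulr2n mulrn_eq0.
Qed.

Lemma sqr_a i : a i * a i = 0.
Proof. exact/eq_opp_mx0/mul_a_a. Qed.

Lemma sqr_adj i : adj (a i) * adj (a i) = 0.
Proof. exact/eq_opp_mx0/mul_adj_adj. Qed.

Lemma adj_number x : adj (N x) = N x.
Proof. by rewrite /Defs.number adjM adjK. Qed.

Lemma number_idem x : N x *m N x = N x.
Proof. exact: (@ladder_number _ _ _ _ mul_a_adj sqr_a None). Qed.

Lemma normsq_number x v : normsq (N x *m v) = normsq (a x *m v).
Proof.
rewrite /normsq (adjM (N x)) adj_number (adjM (a x)) -mulmxA (mulmxA (N x)).
by rewrite number_idem /Defs.number -!mulmxA.
Qed.

(** This is the anticommutator of [a x] and its adjoint evaluated in [v]. Both summands being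
    nonnegative, both operators are nonexpansive. *)
Lemma normsq_a_adj x v : normsq (a x *m v) + normsq (adj (a x) *m v) = normsq v.
Proof.
have h : adj (a x) *m a x + a x *m adj (a x) = 1%:M.
  by rewrite addrC; have := ha.1 x x; rewrite eqxx.
rewrite /normsq !adjM adjK.
suff <- : adj v *m adj (a x) *m (a x *m v) + adj v *m a x *m (adj (a x) *m v)
    = adj v *m v by rewrite [RHS]mxE.
by rewrite -!mulmxA -mulmxDr !(mulmxA _ _ v) -mulmxDl h mul1mx.
Qed.

Lemma nonexpansive_ladder b x : nonexpansive (ladder b x).
Proof.
have c1 : nonexpansive (a x).
  by move=> v; rewrite -(normsq_a_adj x v) lerDl normsq_ge0.
have c2 : nonexpansive (adj (a x)).
  by move=> v; rewrite -(normsq_a_adj x v) lerDr normsq_ge0.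
by case: b => [[]|] //=; exact: nonexpansiveM.
Qed.

Lemma nonexpansive_word s : nonexpansive (word s).
Proof.
elim: s => [|z s ih]; first by rewrite /car_word big_nil; exact: nonexpansive1.
by rewrite word_cons; apply: nonexpansiveM => //; exact: nonexpansive_ladder.
Qed.

Definition npfo_word m (s : seq M) : seq (option bool * M) :=
  [seq (Some true, x) | x <- take m s] ++
  [seq (Some false, x) | x <- take m (drop m s)] ++
  [seq (None, x) | x <- drop (2 * m) s].

Lemma npfoE m s : npfo a m s = word (npfo_word m s).
Proof. by rewrite /car_word !big_cat !big_map /= mulrA. Qed.

Lemma npfo_word_modes m s : map snd (npfo_word m s) = s.
Proof.
rewrite !map_cat -!map_comp /comp !map_id mul2n -addnn -drop_drop.
by rewrite cat_take_drop cat_take_drop.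
Qed.

Lemma count_pair (P : pred (option bool)) b (t : seq M) :
  count (fun z => P z.1) [seq (b, x) | x <- t] = (P b * size t)%N.
Proof. by elim: t => [|x t /= ->]; rewrite ?muln0 // mulnS. Qed.

Lemma npfo_word_even m s : (2 * m <= size s)%N ->
  ~~ odd (count (fun z => isSome z.1) (npfo_word m s)).
Proof.
move=> hm; rewrite !count_cat !(count_pair isSome) /= !size_takel ?size_drop; lia.
Qed.

(** Equally many creations and annihilations make the two counts in [total_number_word] cancel. *)
Lemma npfo_total_number m s : (2 * m <= size s)%N ->
  (\sum_x N x) * npfo a m s = npfo a m s * (\sum_x N x).
Proof.
move=> hm; rewrite npfoE (total_number_word mul_a_adj mul_a_a mul_adj_adj) !count_cat.
rewrite !(count_pair (fun b => b == Some true)) !(count_pair (fun b => b == Some false)).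
by rewrite /= !size_takel ?size_drop ?mul0n ?addn0 ?add0n ?mul1n ?addrK //; lia.
Qed.

Lemma npfo_commute m s m' s' : (2 * m' <= size s')%N ->
  (forall x, x \in s -> x \notin s') ->
  npfo a m s * npfo a m' s' = npfo a m' s' * npfo a m s.
Proof.
move=> hm hd; rewrite !npfoE; apply: (word_commute mul_a_adj mul_a_a mul_adj_adj).
  exact: npfo_word_even.
by rewrite !npfo_word_modes.
Qed.

Lemma nonexpansive_npfo m s : nonexpansive (npfo a m s).
Proof. by rewrite npfoE; exact: nonexpansive_word. Qed.

(** [drop m s] lists the annihilated and the counted modes, whose factors absorb [N x] on the
    right. *)
Lemma npfo_number m s x : uniq s -> x \in drop m s -> npfo a m s * N x = npfo a m s.
Proof.
move=> us; rewrite npfoE -(cat_take_drop m (drop m s)) drop_drop addnn -mul2n.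
rewrite mem_cat => /orP[] hx.
  apply: (word_number mul_a_adj mul_a_a mul_adj_adj sqr_a (b := Some false)) => //.
    by rewrite npfo_word_modes.
  by rewrite !mem_cat (map_f (pair (Some false))) ?orbT.
apply: (word_number mul_a_adj mul_a_a mul_adj_adj sqr_a (b := None)) => //.
  by rewrite npfo_word_modes.
by rewrite !mem_cat (map_f (pair None)) ?orbT.
Qed.

Lemma number_npfo m s x : uniq s -> x \in take m s ++ drop (2 * m) s ->
  N x * npfo a m s = npfo a m s.
Proof.
move=> us; rewrite npfoE mem_cat => /orP[] hx.
  apply: (number_word mul_a_adj mul_a_a mul_adj_adj sqr_adj (b := Some true)) => //.
    by rewrite npfo_word_modes.
  by rewrite !mem_cat (map_f (pair (Some true))).
apply: (number_word mul_a_adj mul_a_a mul_adj_adj sqr_adj (b := None)) => //.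
  by rewrite npfo_word_modes.
by rewrite !mem_cat (map_f (pair None)) ?orbT.
Qed.

End MatrixWords.

(** * Clusters of overlapping terms and their number *)

Section Clusters.
Variables (M : finType) (A : pzRingType) (h : nat -> seq M -> A).
Variables (fam : nat -> seq (seq M)) (k : nat -> nat).
Hypothesis fam_size : forall n j, j \in fam n -> size j = k n.
Hypothesis fam_uniq : forall n j, j \in fam n -> uniq j.
Hypothesis fam_disj : forall n y, (count (fun j => y \in j) (fam n) <= 1)%N.

(* A cluster (t, w) records the modes t, with multiplicity, of a sequence of terms
   each overlapping an earlier one, and the list w of the signed products in the
   expansion of their nested commutator. *)
Definition extend n (t : seq M * seq A) (j : seq M) : seq M * seq A :=
  (j ++ t.1, [seq h n j * P | P <- t.2] ++ [seq - (P * h n j) | P <- t.2]).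

Fixpoint clusters q : seq (seq M * seq A) :=
  match q with
  | 0 => [seq (j, [:: h 1 j]) | j <- fam 1]
  | q'.+1 => [seq extend q'.+2 t j |
               t <- clusters q', j <- [seq j <- fam q'.+2 | has (mem t.1) j]]
  end.

(** The overlap condition is dropped: sizes, commutation and absorption do not depend on it, only
    the count of clusters does. *)
Lemma clusters_ind (Q : nat -> seq M * seq A -> Prop) :
  (forall j, j \in fam 1 -> Q 0 (j, [:: h 1 j])) ->
  (forall q t j, Q q t -> j \in fam q.+2 -> Q q.+1 (extend q.+2 t j)) ->
  forall q t, t \in clusters q -> Q q t.
Proof.
move=> h0 hS; elim=> [|q ih] t /=; first by move=> /mapP[j hj ->]; exact: h0.
move=> /allpairsPdep[t' [j [ht']]]; rewrite mem_filter => /andP[_ hj] ->.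
by apply: hS => //; exact: ih.
Qed.

Lemma cluster_size q t : t \in clusters q -> size t.1 = cumul k q.+2.
Proof.
move: q t; apply: clusters_ind => [j hj|q t j ht hj] /=.
  by rewrite /cumul big_nat1 (fam_size hj).
by rewrite size_cat ht (fam_size hj) /cumul [in RHS]big_nat_recr //= addnC.
Qed.

Lemma cluster_words q t : t \in clusters q -> size t.2 = (2 ^ q)%N.
Proof.
move: q t; apply: clusters_ind => [j hj|q t j ht hj] //=.
by rewrite size_cat !size_map ht expnS mul2n addnn.
Qed.

Lemma has_le_count (s t : seq M) : (has (mem t) s <= \sum_(y <- s) count_mem y t)%N.
Proof.
elim: s => [|y s ih] //=; rewrite big_cons.
case: (boolP (y \in t)) => /= [yt|_]; last exact: leq_trans ih (leq_addl _ _).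
by apply: leq_trans (leq_addr _ _); rewrite -has_count has_pred1.
Qed.

(** Charge each overlapping term to a mode of [t] that it contains; by disjointness a mode is
    charged at most once. *)
Lemma overlap_count n (t : seq M) :
  (\sum_(j <- fam n) has (mem t) j <= size t)%N.
Proof.
apply: (@leq_trans (\sum_(j <- fam n) \sum_(y <- t) (y \in j))).
  apply: leq_sum => j _; rewrite has_sym.
  elim: t => [|y t ih] //=; rewrite big_cons; case: (y \in j) => //=.
rewrite exchange_big /= -sum1_size; apply: leq_sum => y _.
by apply: leq_trans (fam_disj n y); rewrite -sum1_count [leqRHS]big_mkcond.
Qed.

(* Number of clusters of q + 1 terms, with multiplicity, through a given mode: a
   new term either joins a cluster through x, at one of its modes, or contains x,
   in which case it is determined by x and meets the cluster in one of its own
   modes. *)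
Lemma clusters_count q x :
  (\sum_(t <- clusters q) count_mem x t.1 <= \prod_(2 <= m < q.+2) cumul k m.+1)%N.
Proof.
have fam_count n y : (\sum_(j <- fam n) count_mem y j <= 1)%N.
  apply: leq_trans (fam_disj n y); rewrite -sum1_count [leqRHS]big_mkcond /=.
  rewrite big_seq_cond [leqRHS]big_seq_cond; apply: leq_sum => j /andP[hj _].
  by rewrite count_uniq_mem ?(fam_uniq hj)//; case: (y \in j).
elim: q x => [|q ih] x.
  by rewrite big_map big_geq.
rewrite big_nat_recr //= big_allpairs_dep /= mulnC.
under eq_bigr do rewrite big_filter.
have -> : cumul k q.+3 = (cumul k q.+2 + k q.+2)%N by rewrite /cumul big_nat_recr.
rewrite mulnDl.
set T := (\prod_(_ <= _ < _) _)%N in ih *.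
apply: (@leq_trans (\sum_(t <- clusters q) \sum_(j <- fam q.+2)
    ((has (mem t.1) j) * count_mem x t.1 + (has (mem t.1) j) * count_mem x j))%N).
  apply: leq_sum => t _; rewrite big_mkcond; apply: leq_sum => j _ /=.
  by rewrite count_cat; case: has; rewrite ?mul1n // addnC.
under eq_bigr do rewrite big_split /=.
rewrite big_split /=; apply: leq_add.
  apply: (@leq_trans (\sum_(t <- clusters q) cumul k q.+2 * count_mem x t.1)%N).
    rewrite big_seq [leqRHS]big_seq; apply: leq_sum => t ht.
    by rewrite -big_distrl leq_mul2r -(cluster_size ht) overlap_count orbT.
  by rewrite -big_distrr leq_mul2l ih ?orbT.
rewrite exchange_big /=.
apply: (@leq_trans (\sum_(j <- fam q.+2) (k q.+2 * T) * count_mem x j)%N).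
  rewrite big_seq [leqRHS]big_seq; apply: leq_sum => j hj.
  rewrite -big_distrl leq_mul2r; apply/orP; right.
  apply: (@leq_trans (\sum_(t <- clusters q) \sum_(y <- j) count_mem y t.1)%N).
    by apply: leq_sum => t _; exact: has_le_count.
  rewrite exchange_big /= -(fam_size hj) -sum1_size big_distrl /=.
  by apply: leq_sum => y _; rewrite mul1n ih.
by rewrite -big_distrr /= -[leqRHS]muln1 leq_mul2l fam_count orbT.
Qed.

Lemma sum_count (V : nmodType) (f : M -> V) (s : seq M) :
  \sum_(x <- s) f x = \sum_x f x *+ count_mem x s.
Proof.
elim: s => [|y s ih]; first by rewrite big_nil big1.
rewrite big_cons ih [RHS](eq_bigr (fun x => f x *+ (y == x) + f x *+ count_mem x s)).
  rewrite big_split /= [in RHS](bigD1 y) //= eqxx [\sum_(_ | _ != _) _]big1 ?addr0 // => x.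
  by rewrite eq_sym => /negPf ->.
by move=> x _; rewrite mulrnDr.
Qed.

(** After exchanging the sums, [f x] is weighted by the number of clusters through [x]. *)
Lemma clusters_weight (V : numDomainType) (f : M -> V) q : (forall x, 0 <= f x) ->
  \sum_(t <- clusters q) \sum_(x <- t.1) f x <=
  (\sum_x f x) *+ \prod_(2 <= m < q.+2) cumul k m.+1.
Proof.
move=> f0; rewrite (eq_bigr (fun t => \sum_x f x *+ count_mem x t.1)); last first.
  by move=> t _; exact: sum_count.
rewrite exchange_big -sumrMnl; apply: ler_sum => x _.
by rewrite sumrMnr -mulr_natr -[leRHS]mulr_natr ler_wpM2l // ler_nat; exact: clusters_count.
Qed.

End Clusters.

(** * Algebra of nested commutators *)

Section NestedCommutator.
Variables (R : realType) (D : nat).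
Implicit Types (F : nat -> 'M[R[i]]_D).

Lemma nested_comm_eq F F' q : (forall n, (1 <= n <= q.+1)%N -> F n = F' n) ->
  nested_comm F q = nested_comm F' q.
Proof.
elim: q => [|q ih] e /=; first exact: e.
rewrite e ?leqnn // ih // => n /andP[n1 n2]; apply: e.
by rewrite n1 leqW.
Qed.

Lemma nested_commZ (c : nat -> R[i]) F q :
  nested_comm (fun n => c n *: F n) q =
  (\prod_(1 <= n < q.+2) c n) *: nested_comm F q.
Proof.
elim: q => [|q ih] /=; first by rewrite big_nat1.
rewrite big_nat_recr //= ih /comm -!scalemxAl -!scalemxAr !scalerA.
by rewrite (mulrC (c _)) scalerBr.
Qed.

Lemma nested_comm_commute F q B :
  (forall n, (1 <= n <= q.+1)%N -> F n *m B = B *m F n) ->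
  nested_comm F q *m B = B *m nested_comm F q.
Proof.
elim: q => [|q ih] e /=; first exact: e.
have e2 := e q.+2; have {}ih : nested_comm F q *m B = B *m nested_comm F q.
  by apply: ih => n /andP[n1 n2]; apply: e; rewrite n1 leqW.
rewrite /comm mulmxBl mulmxBr -!mulmxA ih e2 ?leqnn //.
by rewrite !mulmxA ih e2 ?leqnn.
Qed.

(** Serves the locality 1 case, with [B] the total number operator. If [c *: B] is the outermost
    entry, everything inside commutes with it; otherwise the inner commutator already vanishes or,
    at the base, is [c *: B] itself. *)
Lemma nested_comm0 F q B c n : (1 <= q)%N -> (1 <= n <= q.+1)%N ->
  (forall n, (1 <= n <= q.+1)%N -> F n *m B = B *m F n) ->
  F n = c *: B -> nested_comm F q = 0.
Proof.
move=> + + + hn; elim: q => [//|q ih] _ /andP[n1 n2] hc.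
have -> : nested_comm F q.+1 = comm (F q.+2) (nested_comm F q) by [].
have hc' m : (1 <= m <= q.+1)%N -> F m *m B = B *m F m.
  by move=> /andP[m1 m2]; apply: hc; rewrite m1 leqW.
have [nq|nq] := eqVneq n q.+2.
  rewrite /comm -nq hn -scalemxAl -scalemxAr (nested_comm_commute hc') subrr //.
have {}n2 : (n <= q.+1)%N by rewrite -ltnS ltn_neqAle nq.
case: q ih n2 hc hc' nq => [|q] ih n2 hc hc' nq.
  have -> : nested_comm F 0 = c *: B by rewrite -hn; congr F; lia.
  by rewrite /comm -scalemxAl -scalemxAr hc // subrr.
by rewrite ih ?n1 // /comm mulmx0 mul0mx subrr.
Qed.

(** A term that misses the cluster commutes with its products and drops out; an overlapping term [h]
    turns [P] into [h * P] and [- (P * h)], as in [extend]. *)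
Lemma nested_comm_clusters (M : finType) (h : nat -> seq M -> 'M[R[i]]_D)
    (fam : nat -> seq (seq M)) q :
  (forall q t j P, t \in clusters h fam q -> P \in t.2 -> j \in fam q.+2 ->
     ~~ has (mem t.1) j -> h q.+2 j * P = P * h q.+2 j) ->
  nested_comm (fun n => \sum_(j <- fam n) h n j) q =
  \sum_(t <- clusters h fam q) \sum_(P <- t.2) P.
Proof.
move=> hc; elim: q => [|q ih] /=.
  by rewrite big_map; apply: eq_bigr => j _; rewrite big_seq1.
rewrite ih big_allpairs_dep /comm mulmx_sumr mulmx_suml -sumrB big_seq [RHS]big_seq.
apply: eq_bigr => t ht; rewrite mulmx_suml mulmx_sumr -sumrB big_filter.
rewrite [RHS]big_mkcond big_seq [RHS]big_seq; apply: eq_bigr => j hj /=.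
case: ifPn => [_|ov]; last first.
  rewrite mulmx_sumr mulmx_suml -sumrB big_seq big1 // => P hP.
  by apply/eqP; rewrite subr_eq0; apply/eqP; exact: hc ht hP hj ov.
by rewrite big_cat !big_map sumrN mulmx_sumr mulmx_suml.
Qed.

End NestedCommutator.

(** * Minima and means over sequences *)

Section SequenceBounds.
Variables (M : eqType) (V : numDomainType) (f : M -> V).
Hypothesis f_ge0 : forall x, 0 <= f x.

(** The order on [V] is only partial, as on complex numbers; nonnegative values are real and hence
    comparable. *)
Lemma exists_min_seq (s : seq M) : s != [::] ->
  exists2 x, x \in s & forall y, y \in s -> f x <= f y.
Proof.
elim: s => [//|z [|w s] ih _].
  by exists z => [|y]; rewrite inE // => /eqP->.
have [//|x xs hx] := ih.
have /orP[zx|xz] : (f z <= f x) || (f x <= f z).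
  by apply: real_leVge; exact: ger0_real.
  exists z => [|y]; rewrite inE ?eqxx // => /orP[/eqP->//|ys].
  exact: le_trans zx (hx y ys).
by exists x => [|y]; rewrite inE ?xs ?orbT // => /orP[/eqP->//|/hx].
Qed.

(** The minimum will do: taken once for each of the at least [q] entries, it stays below the sum. *)
Lemma exists_le_mean q (s : seq M) : (0 < q)%N -> (q <= size s)%N ->
  exists2 x, x \in s & f x *+ q <= \sum_(y <- s) f y.
Proof.
move=> q0 qs; have [|x xs hx] := @exists_min_seq s.
  by rewrite -size_eq0 -lt0n (leq_trans q0).
exists x => //; apply: (@le_trans _ _ (\sum_(y <- s) f x)).
  rewrite big_const_seq count_predT iter_addr_0 -mulr_natr -[leRHS]mulr_natr.
  by rewrite ler_wpM2l // ler_nat.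
by rewrite big_seq [leRHS]big_seq; apply: ler_sum.
Qed.

Lemma sum_subseq_le (s t : seq M) : subseq s t ->
  \sum_(x <- s) f x <= \sum_(x <- t) f x.
Proof.
elim: t s => [|y t ih] [|x s] //=.
- by rewrite big_nil => _; apply: sumr_ge0.
- rewrite [leRHS]big_cons; case: eqP => [->|_] h; first by rewrite big_cons lerD2l ih.
  by apply: le_trans (ih _ h) _; rewrite lerDr.
Qed.

End SequenceBounds.

(** * Matrix elements between states with a fixed number of fermions *)

Section MatrixElements.
Variables (R : realType) (D : nat) (M : finType) (a : M -> 'M[R[i]]_D).
Hypothesis ha : CAR a.
Local Notation N := (Defs.number a).
Implicit Types (psi phi : 'cV[R[i]]_D) (P : 'M[R[i]]_D).

Definition occupation psi t : R[i] := \sum_(x <- t) normsq (a x *m psi).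

(* P vanishes unless each of at least q modes of t is occupied, both in the
   state it acts on and in the state it produces. *)
Definition absorbing q t P :=
  [/\ nonexpansive P,
      exists s, [/\ subseq s t, (q <= size s)%N & forall x, x \in s -> N x * P = P] &
      exists s, [/\ subseq s t, (q <= size s)%N & forall x, x \in s -> P * N x = P]].

Lemma absorbing_bound q t P psi phi : (0 < q)%N -> absorbing q t P ->
  `|(adj psi *m P *m phi) 0 0| *+ 2 *+ q <= occupation psi t + occupation phi t.
Proof.
move=> q0 [cP [s [st qs hs]] [s' [st' qs' hs']]].
have n0 v x : 0 <= normsq (a x *m v) by exact: normsq_ge0.
(* Choose absorbed modes that carry at most a fraction 1/[q] of the occupation of [psi],
   respectively [phi]. *)
have [y ys hy] := exists_le_mean (n0 psi) q0 qs.
have [x xs hx] := exists_le_mean (n0 phi) q0 qs'.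
have e : adj psi *m P *m phi = adj (N y *m psi) *m (P *m (N x *m phi)).
  rewrite -{1}(hs y ys) -{1}(hs' x xs) adjM (adj_number a).
  by rewrite -[N y * _]/(N y *m _) -[P * _]/(P *m N x) -!mulmxA.
apply: (@le_trans _ _ (normsq (a y *m psi) *+ q + normsq (a x *m phi) *+ q)).
  rewrite -mulrnDl lerMn2r; apply/orP; right; rewrite e.
  apply: le_trans (inner_le _ _) _.
  (* What remains is to drop [P] in front of [N x *m phi], which nonexpansiveness allows. *)
  rewrite (normsq_number ha) -(normsq_number ha x) lerD2l.
  exact: cP.
apply: lerD.
  exact: le_trans hy (sum_subseq_le (n0 psi) st).
exact: le_trans hx (sum_subseq_le (n0 phi) st').
Qed.

(** The created and counted modes absorb on the left, the annihilated and counted ones on the right;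
    either way there are [size s - m] of them. *)
Lemma absorbing_npfo q m s : uniq s -> (2 * m <= size s)%N -> (q <= size s - m)%N ->
  absorbing q s (npfo a m s).
Proof.
move=> us hm hq; split; first exact: nonexpansive_npfo.
- exists (take m s ++ drop (2 * m) s); split.
  + rewrite -{3}(cat_take_drop m s) cat_subseq // mul2n -addnn -drop_drop.
    exact: drop_subseq.
  + by rewrite size_cat size_takel ?size_drop; lia.
  + by move=> x; exact: number_npfo.
- exists (drop m s); split; first exact: drop_subseq.
  + by rewrite size_drop.
  + by move=> x; exact: npfo_number.
Qed.

Lemma absorbingN q t P : absorbing q t P -> absorbing q t (- P).
Proof.
move=> [c [s [h1 h2 h3]] [s' [h4 h5 h6]]]; split; first exact: nonexpansiveN.
  by exists s; split => // x xs; rewrite mulrN h3.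
by exists s'; split => // x xs; rewrite mulNr h6.
Qed.

(** Left absorption comes from the left factor and right absorption from the right one, so [t] and
    [u] may overlap. *)
Lemma absorbingM q t u P Q : absorbing q t P -> absorbing q u Q ->
  absorbing q (t ++ u) (P * Q) /\ absorbing q (t ++ u) (Q * P).
Proof.
move=> [c [s [h1 h2 h3]] [s' [h4 h5 h6]]] [d [r [g1 g2 g3]] [r' [g4 g5 g6]]].
have st v : subseq v t -> subseq v (t ++ u).
  by move=> vt; apply: subseq_trans vt (prefix_subseq _ _).
have su v : subseq v u -> subseq v (t ++ u).
  by move=> vt; apply: subseq_trans vt (suffix_subseq _ _).
split; split; try exact: nonexpansiveM.
- by exists s; split; [exact: st| |move=> x xs; rewrite mulrA h3].
- by exists r'; split; [exact: su| |move=> x xs; rewrite -mulrA g6].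
- by exists r; split; [exact: su| |move=> x xs; rewrite mulrA g3].
- by exists s'; split; [exact: st| |move=> x xs; rewrite -mulrA h6].
Qed.

(** The sum is the expectation of the total number operator in [psi]. *)
Lemma occupation_total eta psi : fermion_state a eta psi ->
  \sum_x normsq (a x *m psi) = eta%:R.
Proof.
move=> [h1 h2].
have -> : \sum_x normsq (a x *m psi) = (adj psi *m ((\sum_x N x) *m psi)) 0 0.
  rewrite mulmx_suml mulmx_sumr summxE; apply: eq_bigr => x _.
  by rewrite /normsq adjM /Defs.number !mulmxA.
by rewrite h2 -scalemxAr h1 !mxE eqxx mulr1.
Qed.

Section NestedSums.
Variables (m : nat -> nat) (fam : nat -> seq (seq M)) (k : nat -> nat) (q0 : nat).
Hypothesis fam_size : forall n j, j \in fam n -> size j = k n.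
Hypothesis fam_uniq : forall n j, j \in fam n -> uniq j.
Hypothesis fam_disj : forall n y, (count (fun j => y \in j) (fam n) <= 1)%N.
Hypothesis fam_ladder : forall n j, j \in fam n -> (2 * m n <= size j)%N.
Hypothesis fam_occ : forall n j, j \in fam n -> (q0 <= size j - m n)%N.
Hypothesis q0_gt0 : (0 < q0)%N.
Local Notation h := (fun n s => npfo a (m n) s).

(** Up to sign, each product of the cluster is built from terms supported in [t.1], and every one of
    them commutes with a term disjoint from [t.1]. *)
Lemma cluster_commute q t : t \in clusters h fam q ->
  forall P m' s, P \in t.2 -> (2 * m' <= size s)%N -> ~~ has (mem t.1) s ->
  npfo a m' s * P = P * npfo a m' s.
Proof.
have disj (s u : seq M) : ~~ has (mem u) s -> forall x, x \in u -> x \notin s.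
  move=> /hasPn hs x xu; apply/negP => /hs.
  by rewrite /= xu.
move: q t; apply: clusters_ind => [j hj|q t j ih hj] P m' s /=.
  rewrite inE => /eqP -> hm hd; rewrite -(npfo_commute ha) //.
  exact: disj.
move=> + hm hd; have djs : ~~ has (mem j) s.
  apply: contra hd => /hasP[x xs /= xj]; apply/hasP; exists x => //=.
  by rewrite mem_cat xj.
have dts : ~~ has (mem t.1) s.
  apply: contra hd => /hasP[x xs /= xj]; apply/hasP; exists x => //=.
  by rewrite mem_cat xj orbT.
have cj : npfo a m' s * npfo a (m q.+2) j = npfo a (m q.+2) j * npfo a m' s.
  by symmetry; apply: (npfo_commute ha) hm _; exact: disj.
rewrite mem_cat => /orP[] /mapP[Q hQ ->] /=.
  exact: commrM cj (ih Q _ _ hQ hm dts).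
exact/commrN/(commrM (ih Q _ _ hQ hm dts) cj).
Qed.

Lemma cluster_absorbing q t : t \in clusters h fam q ->
  forall P, P \in t.2 -> absorbing q0 t.1 P.
Proof.
have hnpfo n j : j \in fam n -> absorbing q0 j (npfo a (m n) j).
  by move=> hj; apply: absorbing_npfo; [exact: fam_uniq hj|exact: fam_ladder|exact: fam_occ].
move: q t; apply: clusters_ind => [j hj|q t j ih hj] P /=.
  by rewrite inE => /eqP ->; exact: hnpfo.
rewrite mem_cat => /orP[] /mapP[Q hQ ->].
  exact: (absorbingM (hnpfo _ _ hj) (ih Q hQ)).1.
exact/absorbingN/(absorbingM (hnpfo _ _ hj) (ih Q hQ)).2.
Qed.

Lemma nested_sum_bound q eta psi phi :
  fermion_state a eta psi -> fermion_state a eta phi ->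
  `|(adj psi *m nested_comm (fun n => \sum_(j <- fam n) h n j) q *m phi) 0 0| *+ q0
  <= eta%:R *+ (\prod_(2 <= n < q.+2) cumul k n.+1 * 2 ^ q).
Proof.
move=> hpsi hphi.
rewrite (@nested_comm_clusters _ _ _ h); last first.
  move=> r t j P ht hP hj hd.
  by apply: (cluster_commute ht) => //; exact: fam_ladder.
have step (x y : R[i]) : x <= y -> x *+ 2 *+ q0 <= y *+ 2 *+ q0.
  by move=> xy; do 2! (rewrite lerMn2r; apply/orP; right).
(* Both sides are doubled to match [absorbing_bound]; the 2 cancels in the end because [psi] and
   [phi] contribute [eta] each. *)
suff : `|(adj psi *m (\sum_(t <- clusters h fam q) \sum_(P <- t.2) P) *m phi) 0 0|
    *+ 2 *+ q0 <= eta%:R *+ (\prod_(2 <= n < q.+2) cumul k n.+1 * 2 ^ q) *+ 2.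
  by rewrite mulrnAC lerMn2r.
apply: (@le_trans _ _ (\sum_(t <- clusters h fam q)
   (occupation psi t.1 + occupation phi t.1) *+ 2 ^ q)).
  rewrite mulmx_sumr mulmx_suml summxE.
  apply: le_trans (step _ _ (ler_norm_sum _ _ _)) _.
  rewrite -!sumrMnl big_seq [leRHS]big_seq; apply: ler_sum => t ht.
  rewrite mulmx_sumr mulmx_suml summxE -(cluster_words ht).
  apply: le_trans (step _ _ (ler_norm_sum _ _ _)) _.
  set w := occupation psi t.1 + _.
  have -> : w *+ size t.2 = \sum_(P <- t.2) w.
    by rewrite big_const_seq count_predT iter_addr_0.
  rewrite -!sumrMnl big_seq [leRHS]big_seq.
  by apply: ler_sum => P hP; apply: absorbing_bound => //; exact: cluster_absorbing ht _ hP.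
have occ v : fermion_state a eta v -> \sum_(t <- clusters h fam q) occupation v t.1 <=
    eta%:R *+ \prod_(2 <= n < q.+2) cumul k n.+1.
  move=> hv; rewrite -(occupation_total hv).
  apply: (clusters_weight _ fam_size fam_uniq fam_disj) => x; exact: normsq_ge0.
rewrite sumrMnl big_split /= mulrnA (mulrnAC _ _ 2) lerMn2r; apply/orP; right.
by rewrite mulr2n lerD ?occ.
Qed.

End NestedSums.
End MatrixElements.

(** * Arithmetic of the level factors *)

Section LevelFactor.
Variables (R : realType) (k : nat -> nat).

Lemma cumulS m : (1 <= m)%N -> cumul k m.+1 = (cumul k m + k m)%N.
Proof. by move=> hm; rewrite /cumul big_nat_recr. Qed.

Lemma cumul_ge b p m : (forall n, (1 <= n <= p.+1)%N -> (b <= k n)%N) ->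
  (m <= p.+2)%N -> (b * m.-1 <= cumul k m)%N.
Proof.
move=> hk; elim: m => [|[|m] ih] hm; rewrite ?muln0 //=.
have hkm : (b <= k m.+1)%N by apply: hk; lia.
by rewrite cumulS // mulnS addnC leq_add // ih // ltnW.
Qed.

(** Locality 1 is allowed here, since the sign of the bound is needed in both cases of the main
    argument. *)
Lemma level_factor_ge0 m : (1 <= k m)%N -> (m.-1 <= cumul k m)%N -> (1 <= m)%N ->
  0 <= level_factor R k m.
Proof.
move=> hk hc hm; rewrite /level_factor.
have hk' : 1 <= (k m)%:R :> R by rewrite ler1n.
have hc' : m%:R <= (cumul k m)%:R + 1 :> R by rewrite -(natrD _ _ 1) ler_nat; lia.
apply: mulr_ge0; last exact: powR_ge0.
by rewrite !mulr_ge0 //; lra.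
Qed.

(** The power of 2 is at least 1 and is discarded; the polynomial part alone dominates. *)
Lemma level_factor_ge m : (2 <= k m)%N -> (2 * m.-1 <= cumul k m)%N -> (2 <= m)%N ->
  (2 * cumul k m.+1)%:R <= level_factor R k m.
Proof.
move=> hk hc hm; rewrite /level_factor (cumulS (ltnW hm)) natrM natrD.
have hk' : 2 <= (k m)%:R :> R by rewrite (ler_nat _ 2).
have hm' : 2 <= m%:R :> R by rewrite (ler_nat _ 2).
have hc' : 2 * m%:R <= (cumul k m)%:R + 2 :> R.
  by rewrite -(natrM _ 2) -(natrD _ _ 2) ler_nat; lia.
set x : R := (k m)%:R in hk' *; set y : R := (cumul k m)%:R in hc' *.
set z : R := m%:R in hm' hc' *.
set E := powR _ _.
have E1 : 1 <= E.
  rewrite /E -[leLHS](powRr0 2); apply: ler_powR; first lra.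
  by rewrite addr_ge0 // divr_ge0 // le_min; apply/andP; split; lra.
(* With s = y - (z - 1), the right side is at least 2xs because x >= 2 and s >= 1. Then 2xs >= x +
   2s, as (x - 1)(2s - 1) >= 1, and y <= 2s. *)
have e1 : x + y <= x * (x - 1) * (y - (z - 2)) * (y - (z - 1)).
  have hs : 1 <= y - (z - 1) by lra.
  have hy : y <= 2 * (y - (z - 1)) by lra.
  have -> : y - (z - 2) = y - (z - 1) + 1 by lra.
  set s := y - (z - 1) in hs hy *.
  have h1 : x <= x * (x - 1) by nra.
  have h2 : 2 * s <= (s + 1) * s by nra.
  have h3 : x * (2 * s) <= x * (x - 1) * ((s + 1) * s) by apply: ler_pM => //; lra.
  rewrite -mulrA; apply: le_trans h3; nra.
apply: le_trans (_ : 2 * (x * (x - 1) * (y - (z - 2)) * (y - (z - 1))) <= _).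
  by rewrite ler_pM2l ?ltr0n // addrC.
rewrite !mulrA ler_peMr //.
have : 0 <= x * (x - 1) * (y - (z - 2)) * (y - (z - 1)) by apply: le_trans e1; lra.
by rewrite -!mulrA => ?; apply: mulr_ge0.
Qed.

Lemma ceil_half n : Num.ceil (n%:R / 2 : R) = (uphalf n)%:Z.
Proof.
apply: ceil_def; have := odd_double_half n; rewrite uphalf_half.
move: (odd n) n./2 => b c <-.
rewrite -addnn !natrD intrB -!pmulrn !natrD.
by case: b => /=; lra.
Qed.

Lemma kmin_le p n : (1 <= n <= p.+1)%N -> (kmin k p <= k n)%N.
Proof.
move=> hn; rewrite /kmin.
have : n \in index_iota 1 p.+2 by rewrite mem_index_iota; lia.
elim: (index_iota _ _) => [//|i s ih]; rewrite inE big_cons geq_min.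
by case/orP => [/eqP->|/ih->]; rewrite ?leqnn ?orbT.
Qed.

Lemma kmin_ge b p : (forall n, (1 <= n <= p.+1)%N -> (b <= k n)%N) -> (b <= kmin k p)%N.
Proof.
move=> hk; rewrite /kmin big_seq; apply: (big_ind (fun x => b <= x)%N) => [|x y|n].
- exact: hk.
- by rewrite leq_min => -> ->.
- by rewrite mem_index_iota => hn; apply: hk; lia.
Qed.

End LevelFactor.

(** * The semi-norm, lattice operators and the final estimate *)

Lemma fermionic_norm_le (R : realType) (D : nat) (M : finType) (a : M -> 'M[R[i]]_D)
    (eta : nat) (X : 'M[R[i]]_D) (B : R) : 0 <= B ->
  (forall psi phi, fermion_state a eta psi -> fermion_state a eta phi ->
     cmod ((adj psi *m X *m phi) 0 0) <= B) ->
  fermionic_norm a eta X <= B.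
Proof.
move=> B0 hB; rewrite /fermionic_norm.
(* Without states of [eta] fermions the supremum is 0, whence the assumption on the sign of [B]. *)
have [->|ne] := eqVneq (amplitudes a eta X) set0; first by rewrite sup0.
apply: sup_le_ub; first exact/set0P.
by move=> r [psi [phi [h1 h2 ->]]]; exact: hB.
Qed.

Section LatticeOperators.
Variables (R : realType) (D : nat) (M : finType) (a : M -> 'M[R[i]]_D).
Implicit Types (H : lattice_op R M).

(** Forgetting the tuple lengths puts families of different localities into one type. *)
Definition supports H : seq (seq M) := [seq tval j | j <- enum (op_family H)].

Lemma supportsP H s :
  reflect (exists2 j, j \in op_family H & s = tval j) (s \in supports H).
Proof.
apply: (iffP mapP) => [[j]|[j hj ->]]; first by rewrite mem_enum => hj ->; exists j.
by exists j; rewrite ?mem_enum.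
Qed.

Lemma to_matrixE H : to_matrix a H =
  op_coef H *: \sum_(s <- supports H) npfo a (op_ladder H) s.
Proof. by rewrite /to_matrix big_map -big_enum. Qed.

Lemma supports_uniq H : uniq (supports H).
Proof. by rewrite map_inj_uniq ?enum_uniq //; exact: val_inj. Qed.

(** Two entries of the filtered list would be distinct terms sharing [x]. *)
Lemma supports_disj H x : disjoint_supports H ->
  (count (fun s => x \in s) (supports H) <= 1)%N.
Proof.
move=> hd; rewrite -size_filter.
have : uniq [seq s <- supports H | x \in s] by rewrite filter_uniq // supports_uniq.
have hf s : s \in [seq s <- supports H | x \in s] ->
    exists2 j, j \in op_family H & (s = tval j /\ x \in tval j).
  by rewrite mem_filter => /andP[xs /supportsP[j hj e]]; exists j; rewrite // -e.
case: [seq _ <- _ | _] hf => [|s1 [|s2 u]] //= hf.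
have [j1 h1 [e1 x1]] := hf s1 (mem_head _ _).
have [j2 h2 [e2 x2]] : exists2 j, j \in op_family H & (s2 = tval j /\ x \in tval j).
  by apply: hf; rewrite !inE eqxx orbT.
rewrite inE negb_or => /andP[/andP[ne _] _]; exfalso.
have nj : j1 != j2 by apply: contraNneq ne => e; rewrite e1 e2 e.
by have := hd _ _ h1 h2 nj x x1; rewrite x2.
Qed.

Lemma to_matrix_total_number H : CAR a -> npfo_terms H ->
  to_matrix a H *m (\sum_x Defs.number a x) = (\sum_x Defs.number a x) *m to_matrix a H.
Proof.
move=> ha [hl _]; rewrite to_matrixE -scalemxAl -scalemxAr mulmx_suml mulmx_sumr.
congr (_ *: _); rewrite big_seq [RHS]big_seq; apply: eq_bigr => s /supportsP[j _ ->].
by symmetry; apply: (npfo_total_number ha); rewrite size_tuple.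
Qed.

End LatticeOperators.

(** Locality 1 leaves only number operators. With at most one mode per cell the translations act
    transitively on modes, so the family is empty or contains every mode once. *)
Lemma to_matrix_locality1 (R : realType) (G : finZmodType) (S : finType) (D : nat)
    (a : mode G S -> 'M[R[i]]_D) (H : lattice_op R (mode G S)) :
  npfo_terms H -> translation_invariant H -> locality H = 1%N -> (#|S| <= 1)%N ->
  exists c, to_matrix a H = c *: \sum_x Defs.number a x.
Proof.
move=> [hl _] [ht _] h1 /fintype_le1P S1; rewrite to_matrixE.
have [m0 s1] : op_ladder H = 0%N /\ forall s, s \in supports H -> size s = 1%N.
  split; first lia.
  by move=> s /supportsP[j _ ->]; rewrite size_tuple.
case e : (supports H) => [|s0 u]; first by exists 0; rewrite big_nil scaler0 scale0r.
exists (op_coef H); congr (_ *: _); rewrite -e.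
have hs0 : s0 \in supports H by rewrite e mem_head.
have /supportsP[j0 hj0 e0] := hs0.
have : size s0 = 1%N by exact: s1.
case: s0 {e hs0} e0 => [|x0 [|? ?]] // e0 _.
have pe : perm_eq (supports H) [seq [:: y] | y : mode G S].
  apply: uniq_perm; first exact: supports_uniq.
    by rewrite map_inj_uniq ?enum_uniq // => y z [].
  move=> s; apply/idP/mapP => [hs|[y _ ->]].
    by have := s1 s hs; case: s hs => [|y [|? ?]] // _ _; exists y; rewrite ?mem_enum.
  (* The translation carrying the cell of [x0] to that of [y]; the positions within the cell agree
     by [S1]. *)
  apply/supportsP; exists (map_tuple (translate (y.1 - x0.1)) j0); first exact: ht.
  rewrite /= -e0 /= /translate addrC subrK.
  by congr [:: _]; case: y => y1 y2 /=; congr (_, _); apply: S1.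
rewrite (perm_big _ pe) big_map big_enum /= m0; apply: eq_bigr => y _.
by rewrite /npfo muln0 drop0 /= !big_cons !big_nil !mul1mx mulmx1.
Qed.

(** A locality equal to 1 makes some level factor vanish; [hk1] ensures that the commutator then
    vanishes too. With two modes per cell, the number operator of one sublattice need not commute
    with hopping between the sublattices. *)
Theorem theorem25 (R : realType) (G : finZmodType) (S : finType) (D : nat)
    (a : mode G S -> 'M[R[i]]_D) (ha : CAR a)
    (p : nat) (hp : (1 <= p)%N)
    (H : nat -> lattice_op R (mode G S))
    (hnpfo : forall n, (1 <= n <= p.+1)%N -> npfo_terms (H n))
    (htrans : forall n, (1 <= n <= p.+1)%N -> translation_invariant (H n))
    (hdisj : forall n, (1 <= n <= p.+1)%N -> disjoint_supports (H n))
    (hk : forall n, (1 <= n <= p.+1)%N -> (1 <= locality (H n))%N)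
    (hk1 : forall n, (1 <= n <= p.+1)%N -> locality (H n) = 1%N -> (#|S| <= 1)%N)
    (eta : nat) :
  fermionic_norm a eta (nested_comm (fun n => to_matrix a (H n)) p) <=
  (\prod_(1 <= n < p.+2) cmod (op_coef (H n))) *
  (\prod_(2 <= m < p.+2) level_factor R (fun n => locality (H n)) m) *
  (Num.ceil (eta%:R / (Num.ceil ((kmin (fun n => locality (H n)) p)%:R / 2 : R))%:~R : R))%:~R.
Proof.
set k := fun n => locality (H n).
set C := Num.ceil _.
have C0 : 0 <= C%:~R :> R.
  rewrite (ler_int _ 0) ceil_ge0; apply: lt_le_trans (_ : 0 <= _); first by rewrite ltrN10.
  by rewrite divr_ge0 // ceil_half.
have lf0 m : (1 <= m <= p.+1)%N -> 0 <= level_factor R k m.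
  move=> hm; apply: level_factor_ge0; [exact: hk| |lia].
  by rewrite -[m.-1]mul1n; apply: (@cumul_ge _ 1 p); [exact: hk|lia].
have LF0 : 0 <= \prod_(2 <= m < p.+2) level_factor R k m.
  by rewrite big_nat; apply: prodr_ge0 => m hm; apply: lf0; lia.
have J0 : 0 <= \prod_(1 <= n < p.+2) cmod (op_coef (H n)).
  by apply: prodr_ge0 => n _; rewrite -lecR; exact: (normr_ge0 (op_coef (H n))).
have [/hasP[n]|/hasPn k1] := boolP (has (fun n => k n == 1%N) (index_iota 1 p.+2)).
  rewrite mem_index_iota => hn' /eqP kn.
  have hn : (1 <= n <= p.+1)%N by lia.
  have [c hc] := to_matrix_locality1 a (hnpfo n hn) (htrans n hn) kn (hk1 n hn kn).
  rewrite (@nested_comm0 _ _ _ _ (\sum_x Defs.number a x) c n) //; last first.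
    by move=> r hr; exact: to_matrix_total_number (hnpfo r hr).
  apply: fermionic_norm_le => [|psi phi _ _]; first by rewrite !mulr_ge0.
  by rewrite mulmx0 mul0mx mxE /cmod ComplexField.Normc.normc0 !mulr_ge0.
have k2 n : (1 <= n <= p.+1)%N -> (2 <= k n)%N.
  move=> hn; have := k1 n; rewrite mem_index_iota => /(_ hn) ?.
  by have := hk n hn; rewrite -/(k n); lia.
(* Empty families outside the range make the hypotheses on [fam] hold for every [n]. *)
pose fam n := if (1 <= n <= p.+1)%N then supports (H n) else [::].
have famP n s : s \in fam n ->
    (1 <= n <= p.+1)%N /\ exists2 j, j \in op_family (H n) & s = tval j.
  by rewrite /fam; case: ifP => // hn /supportsP.
pose q0 := uphalf (kmin k p).
have kmin2 : (2 <= kmin k p)%N by exact: kmin_ge.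
have q00 : (0 < q0)%N by rewrite /q0; lia.
pose F n := \sum_(s <- fam n) npfo a (op_ladder (H n)) s.
have -> : nested_comm (fun n => to_matrix a (H n)) p =
    (\prod_(1 <= n < p.+2) op_coef (H n)) *: nested_comm F p.
  rewrite -nested_commZ; apply: nested_comm_eq => n hn.
  by rewrite to_matrixE /F /fam hn.
apply: fermionic_norm_le => [|psi phi hpsi hphi]; first by rewrite !mulr_ge0.
have fam_size n s : s \in fam n -> size s = k n.
  by move=> /famP[_ [j _ ->]]; rewrite size_tuple.
have fam_uniq n s : s \in fam n -> uniq s.
  by move=> /famP[hn [j hj ->]]; exact: (hnpfo n hn).2.
have fam_disj n y : (count (fun s => y \in s) (fam n) <= 1)%N.
  by rewrite /fam; case: ifP => // hn; exact/supports_disj/hdisj.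
have fam_ladder n s : s \in fam n -> (2 * op_ladder (H n) <= size s)%N.
  by move=> /famP[hn [j hj ->]]; rewrite size_tuple; exact: (hnpfo n hn).1.
(* From 2m <= k the number k - m of absorbed modes is at least k/2, and k >= [kmin k p]. *)
have fam_occ n s : s \in fam n -> (q0 <= size s - op_ladder (H n))%N.
  move=> hs; have [hn _] := famP n s hs; have := fam_ladder n s hs.
  by rewrite (fam_size n s hs); have := kmin_le k hn; rewrite /q0; lia.
have := nested_sum_bound ha fam_size fam_uniq fam_disj fam_ladder fam_occ q00 p hpsi hphi.
rewrite -/F; set z := _ 0 0 => hz.
set T := (\prod_(_ <= _ < _) _ * _)%N in hz.
have hT : T%:R <= \prod_(2 <= m < p.+2) level_factor R k m.
  (* The 2^p products per cluster are spread over the p levels, one factor 2 for each. *)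
  have -> : T = (\prod_(2 <= m < p.+2) (2 * cumul k m.+1))%N.
    by rewrite /T big_split /= prod_nat_const_nat mulnC; congr (2 ^ _ * _)%N; lia.
  rewrite natr_prod big_nat [leRHS]big_nat; apply: ler_prod => m hm.
  rewrite ler0n /=; apply: level_factor_ge; [apply: k2; lia| |lia].
  by apply: (@cumul_ge _ 2 p) => //; lia.
clearbody T.
have {}hz : cmod z * q0%:R <= eta%:R * T%:R.
  rewrite -lecR !rmorphM /= !rmorph_nat mulr_natr mulr_natr; exact: hz.
have hC : eta%:R / q0%:R <= C%:~R :> R by rewrite /C ceil_half ceil_ge.
rewrite -scalemxAr -scalemxAl mxE /cmod ComplexField.Normc.normcM.
rewrite (big_morph _ (@ComplexField.Normc.normcM R) (@ComplexField.Normc.normc1 R)).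
rewrite -mulrA ler_wpM2l //.
apply: (@le_trans _ _ (T%:R * (eta%:R / q0%:R))).
  by rewrite mulrA ler_pdivlMr ?ltr0n // [T%:R * _]mulrC.
by apply: ler_pM => //; rewrite divr_ge0.
Qed.
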